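(* Let $K$ be a simplicial complex with vertex set $\{1,\dots,n\}$ and let $(\underline{X},\underline{A})=\{(X_1,A_1),\dots,(X_n,A_n)\}$ be a family of pairs of CW-complexes. Let $(\underline{\Sigma X},\underline{\Sigma A})=\{(\Sigma X_1,\Sigma A_1),\dots,(\Sigma X_n,\Sigma A_n)\}$ be the family of their suspensions, regarded as pointed pairs. Then $$\Sigma \overset{*}{Z}_K(\underline{X},\underline{A})\simeq \hat{Z}_K\left(\underline{\Sigma X},\underline{\Sigma A}\right).$$
   Context: A simplicial complex on a finite vertex set $V$ is a family of subsets of $V$ closed under taking subsets; it contains the empty set as a simplex, and elements of $V$ need not be simplices (ghost vertices are allowed). Complexes are identified with their geometric realizations. Polyhedral join: for a family of CW pairs $(X_i,A_i)$, with every $X_i\neq\emptyset$ and $A_i=\emptyset$ allowed, $$\overset{*}{Z}_K(\underline X,\underline A)=\bigcup_{\sigma\in K}\overset{*}{D}(\sigma)\subseteq X_1*\cdots*X_n,\qquad \overset{*}{D}(\sigma)=Y_1*\cdots*Y_n,$$ where $Y_i=X_i$ if $i\in\sigma$ and $Y_i=A_i$ if $i\notin\sigma$; here $*$ is the join and $Y*\emptyset=Y$. Polyhedral smash product: for a family of pointed CW pairs $(X_i,A_i)$, $$\hat Z_K(\underline X,\underline A)=\bigcup_{\sigma\in K}\hat D(\sigma)\subseteq X_1\wedge\cdots\wedge X_n,\qquad \hat D(\sigma)=Y_1\wedge\cdots\wedge Y_n,$$ with $Y_i=X_i$ if $i\in\sigma$ and $Y_i=A_i$ if $i\notin\sigma$.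 $\Sigma$ is the unreduced suspension with $\Sigma\emptyset=\mathbb{S}^0$ (the two suspension points). The base point of $\Sigma X_i$ and of $\Sigma A_i$ is the suspension point $[\{0\}\times X_i]$. All product spaces carry the compactly generated topology. *)

(* Defs.v *)
From HB Require Import structures.
From Stdlib Require Import Relation_Operators.
From mathcomp Require Import all_boot all_order all_algebra generic_quotient.
From mathcomp Require Import all_classical all_reals all_analysis.

Set Implicit Arguments.
Unset Strict Implicit.
Unset Printing Implicit Defensive.

Import Order.TTheory GRing.Theory Num.Theory.
Import numFieldNormedType.Exports.

Local Open Scope classical_set_scope.
Local Open Scope ring_scope.
Local Open Scope quotient_scope.

Section sum_topology.
Context (T U : topologicalType).

Definition sum_open (W : set (T + U)) : Prop :=
  open (inl @^-1` W) /\ open (inr @^-1` W).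

Let sum_openT : sum_open setT.
Proof. by split; rewrite preimage_setT; exact: openT. Qed.

Let sum_openI (A B : set (T + U)) :
  sum_open A -> sum_open B -> sum_open (A `&` B).
Proof. by move=> [? ?] [? ?]; split; rewrite preimage_setI; exact: openI. Qed.

Let sum_open_bigU (I : Type) (f : I -> set (T + U)) :
  (forall i, sum_open (f i)) -> sum_open (\bigcup_i f i).
Proof.
by move=> fo; split; rewrite preimage_bigcup; apply: bigcup_open => i _;
  case: (fo i).
Qed.

HB.instance Definition _ :=
  isOpenTopological.Build (T + U)%type sum_openT sum_openI sum_open_bigU.

End sum_topology.

(* The compactly generated topology, tested against all continuous maps from
   compact Hausdorff spaces. When [T] is Hausdorff, as are all products of CW
   complexes, this says that a set is closed iff its trace on every compact
   subset is closed. *)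
Definition kify (T : Type) : Type := T.

Section kify_topology.
Context (T : topologicalType).

Definition kopen (U : set (kify T)) : Prop :=
  forall (C : topologicalType) (f : C -> T),
    compact [set: C] -> hausdorff_space C -> continuous f -> open (f @^-1` U).

Let kopenT : kopen setT.
Proof. by move=> C f _ _ _; rewrite preimage_setT; exact: openT. Qed.

Let kopenI (A B : set (kify T)) : kopen A -> kopen B -> kopen (A `&` B).
Proof.
move=> oA oB C f cC hC cf; rewrite preimage_setI.
by apply: openI; [exact: oA|exact: oB].
Qed.

Let kopen_bigU (I : Type) (f : I -> set (kify T)) :
  (forall i, kopen (f i)) -> kopen (\bigcup_i f i).
Proof.
move=> of_ C g cC hC cg; rewrite preimage_bigcup.
by apply: bigcup_open => i _; exact: of_.
Qed.

HB.instance Definition _ := Choice.copy (kify T) T.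
HB.instance Definition _ :=
  isOpenTopological.Build (kify T) kopenT kopenI kopen_bigU.

End kify_topology.

(* Quotient of [T] by the equivalence relation generated by [r]. *)
Section glued.
Context (T : topologicalType) (r : T -> T -> Prop).

Definition glue_eqb (x y : T) : bool := `[< clos_refl_sym_trans T r x y >].

Let glue_refl : reflexive glue_eqb.
Proof. by move=> x; apply/asboolP; exact: rst_refl. Qed.

Let glue_sym : symmetric glue_eqb.
Proof.
by move=> x y; apply/idP/idP => /asboolP xy; apply/asboolP; exact: rst_sym.
Qed.

Let glue_trans : transitive glue_eqb.
Proof.
by move=> y x z /asboolP xy /asboolP yz; apply/asboolP; exact: rst_trans yz.
Qed.

Definition glue_rel : equiv_rel T := EquivRel _ glue_refl glue_sym glue_trans.

Definition glued : Type := {eq_quot glue_rel}.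

HB.instance Definition _ :=
  Topological.copy glued (quotient_topology {eq_quot glue_rel}).
HB.instance Definition _ := Quotient.copy glued {eq_quot glue_rel}.

End glued.

Section suspension.
Context (R : realType).

Definition unitI : topologicalType := `[0%R : R, 1%R]%classic.

Definition cylinder (X : topologicalType) : topologicalType :=
  kify (unitI * X)%type.

(* [inr false] and [inr true] are the suspension points at the ends 0 and 1;
   they are adjoined to the cylinder so that the suspension of the empty space
   is a two-point discrete space. *)
Inductive susp_glue (X : topologicalType) :
    cylinder X + bool -> cylinder X + bool -> Prop :=
| susp_glue0 (t : unitI) (x : X) :
    set_val t = 0 -> susp_glue (inl (t, x)) (inr false)
| susp_glue1 (t : unitI) (x : X) :
    set_val t = 1 -> susp_glue (inl (t, x)) (inr true).

Definition susp (X : topologicalType) : Type := glued (@susp_glue X).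

Section susp_theory.
Context (X : topologicalType).

HB.instance Definition _ := Topological.on (susp X).
HB.instance Definition _ := Quotient.on (susp X).

Definition susp_pole (b : bool) : susp X := \pi_(susp X) (inr b).

Definition susp_pt (t : unitI) (x : X) : susp X :=
  \pi_(susp X) (inl (t, x)).

HB.instance Definition _ := isPointed.Build (susp X) (susp_pole false).

Definition susp_set (A : set X) : set (susp X) :=
  range susp_pole `|` [set susp_pt t a | t in [set: unitI] & a in A].

End susp_theory.

Definition homotopic (X Y : topologicalType) (f g : X -> Y) : Prop :=
  exists2 H : cylinder X -> Y, continuous H &
    forall (t : unitI) (x : X),
      (set_val t = 0 -> H (t, x) = f x) /\ (set_val t = 1 -> H (t, x) = g x).

Definition homotopy_equivalent (X Y : topologicalType) : Prop :=
  exists (f : X -> Y) (g : Y -> X),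
    [/\ continuous f, continuous g,
        homotopic (g \o f) idfun & homotopic (f \o g) idfun].

End suspension.

Arguments susp_set R {X} A.

Section CW.
Context (R : realType).

Definition sqnorm (d : nat) (v : 'rV[R]_d) : R := \sum_(i < d) v 0 i ^+ 2.
Definition disc (d : nat) : set 'rV[R]_d := [set v | sqnorm v <= 1].
Definition odisc (d : nat) : set 'rV[R]_d := [set v | sqnorm v < 1].
Definition sphere (d : nat) : set 'rV[R]_d := [set v | sqnorm v = 1].

(* Only the restriction of [cell_map e] to the closed disc is meaningful. *)
Record CW_structure (X : topologicalType) := {
  cell : Type;
  cell_dim : cell -> nat;
  cell_map : forall e : cell, 'rV[R]_(cell_dim e) -> X;
  open_cell := fun e : cell => @cell_map e @` odisc (d := cell_dim e);
  CW_hausdorff : hausdorff_space X;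
  CW_continuous : forall e,
    {within disc (d := cell_dim e), continuous (@cell_map e)};
  CW_inj : forall e, set_inj (odisc (d := cell_dim e)) (@cell_map e);
  (* with [CW_inj] and [CW_continuous]: the open disc is mapped
     homeomorphically onto the open cell *)
  CW_embedding : forall e (U : set 'rV[R]_(cell_dim e)), open U ->
    exists2 V : set X, open V &
      @cell_map e @` (U `&` odisc (d := cell_dim e)) = V `&` open_cell e;
  CW_disjoint : trivIset [set: cell] open_cell;
  CW_cover : \bigcup_e open_cell e = [set: X];
  CW_closure_finite : forall e, exists2 F : set cell,
    finite_set F /\ (forall e', F e' -> (cell_dim e' < cell_dim e)%N) &
    @cell_map e @` sphere (d := cell_dim e) `<=` \bigcup_(e' in F) open_cell e';
  CW_weak : forall C : set X,
    (forall e, closed (C `&` closure (open_cell e))) -> closed C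
}.

Definition subcomplex (X : topologicalType) (S : CW_structure X)
    (A : set X) : Prop :=
  exists2 E : set (cell S), A = \bigcup_(e in E) open_cell e &
    forall e, E e -> closure (open_cell e) `<=` A.

Definition CW_pair (X : topologicalType) (A : set X) : Prop :=
  exists S : CW_structure X, subcomplex S A.

End CW.

(* [K] may have ghost vertices, and [[set finset.set0]] is allowed. *)
Definition simplicial_complex (V : finType) (K : {set {set V}}) : Prop :=
  finset.set0 \in K /\
  forall s t : {set V}, s \in K -> t \subset s -> t \in K.

Definition face_family (n : nat) (X : 'I_n -> topologicalType)
    (A : forall i, set (X i)) (s : {set 'I_n}) : forall i, set (X i) :=
  fun i => if i \in s then [set: X i] else A i.

Section join.
Context (R : realType) (n : nat) (X : 'I_n -> topologicalType).

Definition simplex : topologicalType :=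
  [set t : 'rV[R]_n | (forall i, 0 <= t 0 i) /\ \sum_(i < n) t 0 i = 1].

Definition join_pre : topologicalType :=
  kify (simplex * prod_topology X)%type.

Definition join_glue (p q : join_pre) : Prop :=
  p.1 = q.1 /\ forall i, 0 < (set_val p.1 : 'rV[R]_n) 0 i -> p.2 i = q.2 i.

(* The join [X_1 * ... * X_n] of nonempty spaces: formal convex combinations
   [\sum_i t_i x_i], in which [x_i] is disregarded when [t_i = 0]. Each [X_i]
   has to be nonempty, for otherwise [join_pre] is empty. With compactly
   generated products this is the iterated binary join. *)
Definition join : Type := glued join_glue.

HB.instance Definition _ := Topological.on join.
HB.instance Definition _ := Quotient.on join.

(* [Y_1 * ... * Y_n] inside [X_1 * ... * X_n]: a point of weight [t_i = 0]
   imposes nothing on [x_i], so that an empty [Y_i] drops out of the join.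
   When every [Y_i] is closed, its own join topology is the subspace one. *)
Definition subjoin (Y : forall i, set (X i)) : set join :=
  [set \pi_join p | p in [set p : join_pre |
    forall i, 0 < (set_val p.1 : 'rV[R]_n) 0 i -> Y i (p.2 i)]].

Definition polyhedral_join (K : {set {set 'I_n}}) (A : forall i, set (X i)) :
    set join :=
  \bigcup_(s in [set s | s \in K]) subjoin (face_family A s).

End join.

Arguments subjoin R {n X} Y.
Arguments polyhedral_join R {n X} K A.

Section smash.
Context (n : nat) (X : 'I_n -> ptopologicalType).

Definition kprod : topologicalType := kify (prod_topology X).

Definition smash_pre : topologicalType :=
  (kprod + discrete_topology unit)%type.

(* The quotient of the product by the fat wedge, with the base point [inr tt]
   adjoined beforehand. For [n > 0] the fat wedge is nonempty and this is the
   plain quotient; for [n = 0] it is the two-point space, the unit of the smash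
   product. *)
Inductive smash_glue : smash_pre -> smash_pre -> Prop :=
| smash_glue_pt (x : kprod) (i : 'I_n) :
    x i = point -> smash_glue (inl x) (inr tt).

Definition smash : Type := glued smash_glue.

HB.instance Definition _ := Topological.on smash.
HB.instance Definition _ := Quotient.on smash.

Definition subsmash (Y : forall i, set (X i)) : set smash :=
  \pi_smash (inr tt) |`
    [set \pi_smash (inl x) | x in [set x : kprod | forall i, Y i (x i)]].

Definition polyhedral_smash (K : {set {set 'I_n}}) (A : forall i, set (X i)) :
    set smash :=
  \bigcup_(s in [set s | s \in K]) subsmash (face_family A s).

End smash.

Arguments subsmash {n} X Y.
Arguments polyhedral_smash {n} X K A.

(* Main.v *)
Require Import Defs.
From Stdlib Require Import Relation_Operators.
From mathcomp Require Import all_boot all_order all_algebra generic_quotient.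
From mathcomp Require Import all_classical all_reals all_analysis.

(** The two spaces are homeomorphic. Away from its base point at height 0, the
suspension of [X i] is an open cone on [X i], with its apex at height 1. So the
smash product of the suspensions is, away from its base point, a product of open
cones, which is the open cone on the join; adding the base point turns it into
the suspension of the join. Explicitly, the point at height [s] above the formal
convex combination [sum_i t_i x_i] corresponds to the point of the smash product
whose [i]-th coordinate lies above [x_i] at height
[1 - (1 - s) * t_i / max_j t_j]. The smallest of these heights is [s], so the
base point is met exactly when [s = 0]. The [i]-th height is [1] exactly when
[s = 1] or [t_i = 0], and in these cases [x_i] is forgotten on both sides.

To avoid an inverse formula, which would not be visibly continuous at the apex,
both spaces are exhibited as quotients of one space of coordinates [(s, t, x)]
([susp_join_of_quotient_map] and [smash_susp_of_quotient_map]). The two maps have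
the same fibres ([same_fibres]), so their targets are homeomorphic
([quotient_comparison]). That the maps are quotient maps rests on three facts:
the product of a quotient map with a compact Hausdorff space is a quotient map
([open_prod_quotient]); in compactly generated products, so is a finite product
of quotient maps ([kopen_prod_quotient]); and the map from heights and weights to
the cube of coordinate heights is a surjection of compact Hausdorff spaces
([spread_quotient_map]).

The homeomorphism takes the suspension of the polyhedral join, as a subset, onto
the polyhedral smash product ([polyhedral_image]). It remains to compare the
topology of the suspension of the polyhedral join with that of this subset of the
suspended join. They agree because the polyhedral join is closed in the join
([susp_closed_embedding]), and this in turn holds because subcomplexes are closed
([subcomplex_closed]). *)

Set Implicit Arguments.
Unset Strict Implicit.
Unset Printing Implicit Defensive.

Import Order.TTheory GRing.Theory Num.Theory.
Import numFieldNormedType.Exports.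

Local Open Scope classical_set_scope.
Local Open Scope ring_scope.
Local Open Scope quotient_scope.

(** * Maps between topological spaces *)

Lemma open_preimage (T U : topologicalType) (f : T -> U) (W : set U) :
  continuous f -> open W -> open (f @^-1` W).
Proof. by move=> /continuousP; exact. Qed.

Lemma continuous_compose (S T U : topologicalType) (f : S -> T) (g : T -> U) :
  continuous f -> continuous g -> continuous (fun x => g (f x)).
Proof. by move=> cf cg x; exact: (continuous_comp (cf x) (cg (f x))). Qed.

Lemma continuous_ident (T : topologicalType) : continuous (fun x : T => x).
Proof. by move=> x; exact: cvg_id. Qed.

Lemma continuous_const (T U : topologicalType) (u : U) :
  continuous (fun _ : T => u).
Proof. by move=> x; exact: cvg_cst. Qed.

Lemma continuous_fst (T U : topologicalType) : continuous (@fst T U).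
Proof. by move=> x; exact: cvg_fst. Qed.

Lemma continuous_snd (T U : topologicalType) : continuous (@snd T U).
Proof. by move=> x; exact: cvg_snd. Qed.

Lemma continuous_pair (S T U : topologicalType) (f : S -> T) (g : S -> U) :
  continuous f -> continuous g -> continuous (fun x => (f x, g x)).
Proof. by move=> cf cg x; apply: cvg_pair; [exact: cf|exact: cg]. Qed.

Lemma continuous_proj (I : eqType) (T : I -> topologicalType) (i : I) :
  continuous (fun x : prod_topology T => x i).
Proof. exact: (@proj_continuous I T i). Qed.

Lemma continuous_tuple (I : eqType) (S : topologicalType)
    (T : I -> topologicalType) (f : S -> prod_topology T) :
  (forall i, continuous (fun x => f x i)) -> continuous f.
Proof.
move=> cf x; apply/cvg_sup => i W [_ [[V oV <-] Vx]] /filterS; apply.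
exact: (cf i x V (open_nbhs_nbhs (conj oV Vx))).
Qed.

Lemma continuous_set_val (T : topologicalType) (A : set T) :
  continuous (set_val : A -> T).
Proof. exact: initial_continuous. Qed.

Lemma continuous_into_set (S T : topologicalType) (A : set T) (f : S -> A) :
  continuous (fun x => set_val (f x)) -> continuous f.
Proof.
move=> /continuousP cf; apply/continuousP => _ [W oW <-].
exact: cf.
Qed.

Lemma cluster_image (T U : topologicalType) (f : T -> U) (p q : T) :
  continuous f -> cluster (nbhs p) q -> cluster (nbhs (f p)) (f q).
Proof.
move=> cf pq A B /cf pA /cf qB.
by have [x [Ax Bx]] := pq _ _ pA qB; exists (f x).
Qed.

Lemma hausdorff_inj (T U : topologicalType) (f : T -> U) :
  continuous f -> injective f -> hausdorff_space U -> hausdorff_space T.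
Proof. by move=> cf fI hU p q pq; apply/fI/hU/cluster_image. Qed.

Lemma hausdorff_setX (T U : topologicalType) :
  hausdorff_space T -> hausdorff_space U -> hausdorff_space (T * U)%type.
Proof.
move=> hT hU [a b] [c d] pq; congr pair.
  exact: hT (cluster_image (@continuous_fst T U) pq).
exact: hU (cluster_image (@continuous_snd T U) pq).
Qed.

Lemma compact_setXT (T U : topologicalType) :
  compact [set: T] -> compact [set: U] -> compact [set: (T * U)%type].
Proof. by rewrite -setXTT; exact: compact_setX. Qed.

Lemma compact_set_type (T : topologicalType) (A : set T) :
  compact A -> compact [set: A].
Proof.
move=> cA F FF _.
have FA : ((set_val : A -> T) @ F) A.
  by apply: (@filterS _ F _ setT) => [x _|]; [exact: set_valP|exact: filterT].
have [p [Ap clp]] := cA _ (fmap_proper_filter (set_val : A -> T) FF) FA.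
exists (SigSub (mem_set Ap)); split => // B C FB [_ [[V oV <-] Vp]] VC.
have FB' : ((set_val : A -> T) @ F) (set_val @` B).
  by apply: (@filterS _ F _ B) => // x Bx; exists x.
have [_ [[x Bx <-] Vx]] := clp _ _ FB' (open_nbhs_nbhs (conj oV Vp)).
by exists x; split=> //; exact: VC.
Qed.

(** * Quotient maps and compactly generated products *)

Lemma tube (T U : topologicalType) (N : set T) (W : set (T * U)) (u : U) :
  compact N -> open W -> (forall x, N x -> W (x, u)) ->
  \forall v \near u, forall x, N x -> W (x, v).
Proof.
move=> /compact_near_coveringP cN oW NW.
apply: (cN U (nbhs u) (fun v x => W (x, v))) => x /NW Wxu.
have : nbhs (x, u) W by exact: open_nbhs_nbhs.
by case=> -[P Q] /= [xP uQ] PQ; exists (P, Q) => // -[a b] /PQ.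
Qed.

(** A compact Hausdorff space is regular, so a neighbourhood contains a closed,
hence compact, one: such spaces are locally compact in the strong sense that
the two product lemmas below rely on. *)
Lemma compact_nbhs_in (C : topologicalType) (c : C) (W : set C) :
  compact [set: C] -> hausdorff_space C -> nbhs c W ->
  exists N, [/\ nbhs c N, compact N & N `<=` W].
Proof.
move=> cC hC /(compact_regular hC cC filterT) [N cN NW].
exists (closure N); split=> //; first exact: filterS (@subset_closure _ _) cN.
apply: subclosed_compact cC _ => //; exact: closed_closure.
Qed.

(** The spaces that carry the compactly generated topology already. The product
topology with a compact Hausdorff factor is then the right one as well
([open_prod_kspace]). *)
Definition kspace (T : topologicalType) : Prop :=
  forall W : set T, kopen W -> open W.

Definition quotient_map (T U : topologicalType) (q : T -> U) : Prop :=
  (forall u, exists t, q t = u) /\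
  forall W : set U, open (q @^-1` W) <-> open W.

Lemma quotient_map_continuous (T U : topologicalType) (q : T -> U) :
  quotient_map q -> continuous q.
Proof. by move=> [_ qO]; apply/continuousP => W /qO. Qed.

Lemma open_kify (T : topologicalType) (W : set T) :
  open (W : set (kify T)) <-> kopen W.
Proof. by []. Qed.

(** Together with [continuous_from_kify], this reduces every continuity question
about compactly generated spaces to maps out of compact Hausdorff spaces, for
which the coarse topology suffices. *)
Lemma continuous_to_kify (C T : topologicalType) (f : C -> T) :
  compact [set: C] -> hausdorff_space C -> continuous f ->
  continuous (f : C -> kify T).
Proof.
by move=> cC hC cf; apply/continuousP => W oW; exact: (oW C f cC hC cf).
Qed.

Lemma continuous_from_kify (T U : topologicalType) (f : T -> U) :
  (forall (C : topologicalType) (u : C -> T), compact [set: C] ->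
     hausdorff_space C -> continuous u -> continuous (fun c => f (u c))) ->
  continuous (f : kify T -> U).
Proof.
move=> cf; apply/continuousP => W oW.
apply/open_kify => C u cC hC cu.
exact: (open_preimage (cf C u cC hC cu) oW).
Qed.

Lemma continuous_kify (T U : topologicalType) (f : T -> U) :
  continuous f -> continuous (f : kify T -> U).
Proof.
by move=> cf; apply: continuous_from_kify => C u _ _ /continuous_compose; apply.
Qed.

Lemma kspace_kify (T : topologicalType) : kspace (kify T).
Proof.
move=> W kW; apply/open_kify => C u cC hC cu.
by apply: kW => //; exact: continuous_to_kify.
Qed.

(** The product with a compact Hausdorff space is already compactly generated.
Around [(c0, t0)] one finds a box [N * V] inside [W], where [N] is a compact
neighbourhood of [c0] in the slice of [W] over [t0] and [V] is the set of all
[t] with [N * {t}] inside [W]; the tube lemma shows that [V] is open when tested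
on a compact space. *)
Lemma open_prod_kspace (C T : topologicalType) (W : set (C * T)) :
  compact [set: C] -> hausdorff_space C -> kspace T -> kopen W -> open W.
Proof.
move=> cC hC kT kW.
have sliceO t : open [set c | W (c, t)].
  apply: (kW C (fun c => (c, t))) => //.
  exact: continuous_pair (@continuous_ident C) (@continuous_const _ _ _).
rewrite openE => -[c0 t0] Wct0; rewrite /interior.
have [N [Nc0 cN NW]] := compact_nbhs_in cC hC
  (open_nbhs_nbhs (conj (sliceO t0) Wct0)).
pose V := [set t | forall c, N c -> W (c, t)].
have oV : open V.
  apply: kT => D f cD hD cf.
  rewrite openE => d Vd; rewrite /interior.
  apply: (@tube C D N [set p | W (p.1, f p.2)] d) => //.
  apply: (kW _ (fun p : C * D => (p.1, f p.2))).
  - exact: compact_setXT.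
  - exact: hausdorff_setX.
  - apply: continuous_pair; first exact: continuous_fst.
    exact: continuous_compose (@continuous_snd C D) cf.
exists (N, V); last by case=> c t /= [Nc Vt]; exact: Vt.
by split=> //=; apply: open_nbhs_nbhs; split.
Qed.

(** Whitehead's theorem: multiplying a quotient map by a compact Hausdorff space
gives a quotient map. The box argument is that of [open_prod_kspace], the set
[V] being now open because its preimage under [q] is, by the tube lemma. *)
Lemma open_prod_quotient (C T U : topologicalType) (q : T -> U)
    (W : set (C * U)) :
  compact [set: C] -> hausdorff_space C -> quotient_map q ->
  open [set p : C * T | W (p.1, q p.2)] -> open W.
Proof.
move=> cC hC [qs qO] oW.
rewrite openE => -[c0 u0] Wcu0; rewrite /interior.
have [t0 t0E] := qs u0.
have oW0 : open [set c | W (c, u0)].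
  rewrite -t0E; apply: (open_preimage (f := fun c => (c, t0)) _ oW).
  exact: continuous_pair (@continuous_ident C) (@continuous_const _ _ _).
have [N [Nc0 cN NW]] := compact_nbhs_in cC hC
  (open_nbhs_nbhs (conj oW0 Wcu0)).
pose V := [set u | forall c, N c -> W (c, u)].
have oV : open V.
  apply/qO; rewrite openE => t Vt; rewrite /interior.
  exact: (@tube C T N [set p | W (p.1, q p.2)] t).
exists (N, V); last by case=> c t /= [Nc Vt]; exact: Vt.
by split=> //=; apply: open_nbhs_nbhs; split.
Qed.

(** A compactly generated product of quotient maps is a quotient map. On a test
map [f] into the product of the [Y i], the coordinates are lifted through [q]
one at a time: if all coordinates outside [k :: s] lift, then freeing the
[k]-th one gives a subset of [C * X k] which is tested by maps whose coordinates
lift outside [s], so it is open by induction and [open_prod_kspace];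
[open_prod_quotient] pushes it down to [C * Y k], and [f] itself is recovered by
substituting its own [k]-th coordinate. *)
Lemma kopen_prod_quotient (I : finType) (X Y : I -> topologicalType)
    (q : forall i, X i -> Y i) (W : set (prod_topology Y)) :
  (forall i, quotient_map (q i)) -> (forall i, kspace (X i)) ->
  @kopen (prod_topology X) [set x | W (fun i => q i (x i))] -> kopen W.
Proof.
move=> qq kX kW.
suff lifted (s : seq I) (C : topologicalType) (f : C -> prod_topology Y) :
    compact [set: C] -> hausdorff_space C -> continuous f ->
    (forall i, i \notin s -> exists2 g : C -> X i, continuous g &
       forall c, f c i = q i (g c)) -> open (f @^-1` W).
  by move=> C f cC hC cf; apply: (lifted (enum I)) => // i; rewrite mem_enum.
elim: s C f => [|k s IH] C f cC hC cf fl.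
  pose g i := projT1 (cid2 (fl i isT)).
  have cg i : continuous (g i) by rewrite /g; case: cid2.
  have fE : f = fun c i => q i (g i c).
    apply/funext => c; apply: functional_extensionality_dep => i.
    by rewrite /g; case: cid2.
  rewrite fE; apply: (kW C (fun c i => g i c)) => //.
  exact: continuous_tuple.
pose h (c : C) (y : Y k) : prod_topology Y := dfwith (f c) k y.
have ch (D : topologicalType) (u : D -> C) (y : D -> Y k) :
    continuous u -> continuous y -> continuous (fun d => h (u d) (y d)).
  move=> cu cy; apply: continuous_tuple => i.
  have [<-{i}|ki] := eqVneq k i.
    by rewrite /h; under eq_fun do rewrite dfwithin.
  rewrite /h; under eq_fun do rewrite dfwithout //.
  exact: continuous_compose (continuous_compose cu cf) (@continuous_proj _ _ i).
have oXW : open [set p : C * X k | W (h p.1 (q k p.2))].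
  apply: open_prod_kspace => // D u cD hD cu.
  have cu1 := continuous_compose cu (@continuous_fst C (X k)).
  have cu2 := continuous_compose cu (@continuous_snd C (X k)).
  apply: (IH D (fun d => h (u d).1 (q k (u d).2))) => //.
    apply: ch cu1 (continuous_compose cu2 _).
    exact: quotient_map_continuous.
  move=> i; have [<-{i} _|ki iNs] := eqVneq k i.
    by exists (fun d => (u d).2) => // d; rewrite /h dfwithin.
  have [|g cg fg] := fl i; first by rewrite inE negb_or eq_sym ki.
  exists (fun d => g (u d).1); first exact: continuous_compose cu1 cg.
  by move=> d; rewrite /h dfwithout.
have oYW : open [set p : C * Y k | W (h p.1 p.2)].
  exact: open_prod_quotient (qq k) oXW.
rewrite (_ : f @^-1` W = (fun c => (c, f c k)) @^-1` [set p | W (h p.1 p.2)]).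
  apply: open_preimage oYW; apply: continuous_pair.
    exact: continuous_ident.
  exact: continuous_compose cf (@continuous_proj _ _ k).
apply/funext => c /=; congr (W _); apply: functional_extensionality_dep => i.
by rewrite /h; have [<-|ki] := eqVneq k i; rewrite ?dfwithin ?dfwithout.
Qed.

(** * Points and open sets of suspensions, smash products and joins *)

Lemma open_sum_discrete (T : topologicalType) (D : discreteTopologicalType)
    (W : set (T + D)) :
  open W <-> open [set t | W (inl t)].
Proof. by split=> [[]//|oW]; split=> //; exact: discrete_open. Qed.

Lemma closed_kify (T : topologicalType) (F : set T) :
  (forall (C : topologicalType) (u : C -> T), compact [set: C] ->
     hausdorff_space C -> continuous u -> closed (u @^-1` F)) ->
  closed (F : set (kify T)).
Proof.
move=> cF; rewrite -openC; apply/open_kify => C u cC hC cu.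
by rewrite preimage_setC openC; exact: cF.
Qed.

Section gluing.
Context (T : topologicalType) (r : T -> T -> Prop).

Lemma glued_eqP (a b : T) :
  \pi_(glued r) a = \pi_(glued r) b <-> clos_refl_sym_trans T r a b.
Proof. by split=> [/eqmodP/asboolP//|ab]; apply/eqmodP/asboolP. Qed.

(** Points of a glued space are told apart by applying this to a function that
respects the gluing and separates them; the local functions [height] and [core]
below serve this purpose. *)
Lemma glued_lift (U : Type) (f : T -> U) (a b : T) :
  (forall x y, r x y -> f x = f y) ->
  \pi_(glued r) a = \pi_(glued r) b -> f a = f b.
Proof.
move=> fr /glued_eqP; elim=> {a b} [x y /fr//|//|//|x y z _ -> _ ->//].
Qed.

Lemma glued_surj (z : glued r) : exists a, \pi_(glued r) a = z.
Proof. by exists (repr z); exact: reprK. Qed.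

Lemma glued_quotient_map : quotient_map (\pi_(glued r) : T -> glued r).
Proof. by split; [exact: glued_surj|move=> W]. Qed.

End gluing.

Section suspension_points.
Context (R : realType) (X : topologicalType).
Local Notation I := (unitI R).
Implicit Types (t : I) (x : X) (b : bool) (z : susp R X).

Lemma unitI_ge0 t : 0 <= set_val t :> R.
Proof. by have := set_valP t; rewrite /= in_itv => /andP[]. Qed.

Lemma unitI_le1 t : set_val t <= 1 :> R.
Proof. by have := set_valP t; rewrite /= in_itv => /andP[]. Qed.

Lemma susp_pt_pole t x b : set_val t = b%:R -> susp_pt t x = susp_pole R X b.
Proof.
move=> tb; apply/glued_eqP/rst_step; case: b tb => tb; last exact: susp_glue0.
exact: susp_glue1.
Qed.

Lemma susp_ind (P : susp R X -> Prop) :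
  (forall b, P (susp_pole R X b)) -> (forall t x, P (susp_pt t x)) ->
  forall z, P z.
Proof.
by move=> Pb Pt z; case: (glued_surj z) => -[[t x]|b] <-; [exact: Pt|exact: Pb].
Qed.

Let height (c : cylinder R X + bool) : R :=
  match c with inl p => set_val p.1 | inr b => b%:R end.

Let core (c : cylinder R X + bool) : option X :=
  match c with
  | inl p => if (set_val p.1 == 0 :> R) || (set_val p.1 == 1 :> R) then None
             else Some p.2
  | inr _ => None
  end.

Let height_glue c d : susp_glue c d -> height c = height d.
Proof. by case. Qed.

Let core_glue c d : susp_glue c d -> core c = core d.
Proof. by case=> t x /= ->; rewrite eqxx ?orbT. Qed.

Lemma susp_pole_inj : injective (susp_pole R X).
Proof.
move=> b c /(glued_lift height_glue) /=.
by case: b; case: c => //= /eqP; rewrite ?oner_eq0 // eq_sym oner_eq0.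
Qed.

Lemma susp_pt_eq_pole t x b :
  susp_pt t x = susp_pole R X b <-> set_val t = b%:R :> R.
Proof. by split=> [/(glued_lift height_glue)//|]; exact: susp_pt_pole. Qed.

Lemma susp_pt_eq t u x y :
  susp_pt t x = susp_pt u y <->
  t = u /\ (0 < (set_val t : R) -> (set_val t : R) < 1 -> x = y).
Proof.
split=> [e|[<- xy]].
  have := glued_lift height_glue e => /= /val_inj <-; split=> // t0 t1.
  have := glued_lift core_glue e => /=.
  by rewrite gt_eqF // lt_eqF //= => -[]; case: ifP => // _ -[].
have [t0|t0] := eqVneq (set_val t : R) 0.
  by rewrite !(@susp_pt_pole _ _ false).
have [t1|t1] := eqVneq (set_val t : R) 1.
  by rewrite !(@susp_pt_pole _ _ true).
by rewrite xy // lt_neqAle ?unitI_ge0 ?unitI_le1 ?andbT // eq_sym.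
Qed.

(** The adjoined poles are isolated before gluing, so they impose no condition
on open sets. *)
Lemma susp_open (W : set (susp R X)) :
  open W <-> open [set p : cylinder R X | W (susp_pt p.1 p.2)].
Proof.
rewrite (_ : [set p | _] = [set p | W (\pi_(susp R X) (inl p))]); last first.
  by apply/funext => -[].
exact: (@open_sum_discrete (cylinder R X) bool
  [set c | W (\pi_(susp R X) c)]).
Qed.

End suspension_points.

Section smash_points.
Context (n : nat) (X : 'I_n -> ptopologicalType).
Implicit Types x y : prod_topology X.

Definition smash_pt x : smash X := \pi_(smash X) (inl x).
Definition smash_base : smash X := \pi_(smash X) (inr tt).

Lemma smash_ind (P : smash X -> Prop) :
  P smash_base -> (forall x, P (smash_pt x)) -> forall z, P z.
Proof.
by move=> P0 P1 z; case: (glued_surj z) => -[x|[]] <-; [exact: P1|exact: P0].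
Qed.

Let core (c : smash_pre X) : option (prod_topology X) :=
  match c with
  | inl x => if `[< exists i, x i = point >] then None else Some x
  | inr _ => None
  end.

Let core_glue c d : smash_glue c d -> core c = core d.
Proof. by case=> x i xi /=; rewrite asboolT //; exists i. Qed.

Lemma smash_pt_eq_base x : smash_pt x = smash_base <-> exists i, x i = point.
Proof.
split=> [/(glued_lift core_glue)/=|[i xi]]; first by case: asboolP.
exact/glued_eqP/rst_step/(smash_glue_pt xi).
Qed.

Lemma smash_pt_inj x y : smash_pt x <> smash_base ->
  smash_pt x = smash_pt y -> x = y.
Proof.
move=> xb xy; have yb : smash_pt y <> smash_base by rewrite -xy.
have := glued_lift core_glue xy => /=.
by rewrite !asboolF => [[]|/smash_pt_eq_base|/smash_pt_eq_base].
Qed.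

Lemma smash_open (W : set (smash X)) :
  open W <-> open [set x : kprod X | W (smash_pt x)].
Proof.
exact: (@open_sum_discrete (kprod X) (discrete_topology unit)
  [set c | W (\pi_(smash X) c)]).
Qed.

End smash_points.

(** The gluing relation of the join is already an equivalence relation. *)
Lemma join_eqP (R : realType) (n : nat) (X : 'I_n -> topologicalType)
    (p q : join_pre R X) :
  \pi_(join R X) p = \pi_(join R X) q <-> join_glue p q.
Proof.
split=> [/glued_eqP|pq]; last exact/glued_eqP/rst_step.
elim=> {p q} [//|p|p q _ [pq1 pq2]|p q s _ [pq1 pq2] _ [qs1 qs2]].
- by split.
- by split=> // i; rewrite -pq1 => /pq2.
- split=> [|i ti]; first by rewrite pq1.
  by rewrite pq2 // qs2 // -pq1.
Qed.

(** * Homeomorphisms from quotients and from closed embeddings *)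

(** A closed embedding is a homeomorphism onto its range, and a homeomorphism is
a homotopy equivalence through constant homotopies. *)
Lemma closed_embedding_homotopy_equivalent (R : realType)
    (P Q : topologicalType) (j : P -> Q) (B : set Q) :
  continuous j -> injective j -> (forall F, closed F -> closed (j @` F)) ->
  range j = B -> homotopy_equivalent R P (set_type B).
Proof.
move=> cj jI jC jB.
have jinB p : j p \in B by apply/mem_set; rewrite -jB; exists p.
pose f p : B := SigSub (jinB p).
have jP x : B x -> exists p, j p = x by rewrite -jB => -[p _ <-]; exists p.
have gP (b : B) : exists p, j p = set_val b := jP _ (set_valP b).
pose g b := projT1 (cid (gP b)).
have gE b : j (g b) = set_val b by rewrite /g; case: cid.
have const_homotopic (T : topologicalType) (h : T -> T) :
    h =1 id -> homotopic R h idfun.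
  move=> hE; exists (fun p => p.2); last by move=> t x; split=> _ /=.
  exact: (continuous_kify (@continuous_snd (unitI R) T)).
exists f, g; split.
- exact: continuous_into_set.
- apply/continuous_closedP => F cF.
  rewrite (_ : g @^-1` F = set_val @^-1` (j @` F)).
    by apply: preimage_closed (jC _ cF) => // x _; exact: continuous_set_val.
  apply/seteqP; split=> b /=; first by exists (g b).
  by case=> p Fp; rewrite -gE => /jI <-.
- by apply: const_homotopic => p; apply: jI; rewrite /= gE.
- by apply: const_homotopic => b; apply: val_inj; rewrite /= gE.
Qed.

(** A quotient map determines the topology and the points of its target, so two
quotients of [T] with the same fibres are homeomorphic. *)
Lemma quotient_comparison (T P Q : topologicalType) (p : T -> P) (q : T -> Q) :
  quotient_map p -> quotient_map q ->
  (forall a b, p a = p b <-> q a = q b) ->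
  exists h : P -> Q, [/\ forall a, h (p a) = q a, continuous h, injective h &
    forall F, closed F -> closed (h @` F)].
Proof.
move=> pq qq pqE; have [ps pO] := pq; have [qs qO] := qq.
pose h x := q (projT1 (cid (ps x))).
have hE a : h (p a) = q a by rewrite /h; case: cid => b /= /pqE.
exists h; split=> //.
- apply/continuousP => W /qO; rewrite -pO.
  by rewrite (_ : p @^-1` _ = q @^-1` W) //; apply/funext => a /=; rewrite hE.
- move=> x y; have [a <-] := ps x; have [b <-] := ps y.
  by rewrite !hE => /pqE.
- move=> F; rewrite -!openC => /pO; rewrite -qO.
  rewrite (_ : p @^-1` _ = q @^-1` (~` (h @` F))) //.
  apply/seteqP; split=> a /= Fa; last by move=> Fpa; apply: Fa; exists (p a).
  by case=> x; have [b <-] := ps x; rewrite hE => Fb /pqE ba; rewrite -ba in Fa.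
Qed.

(** The topology of the suspension of [A] is generated from that of [A] alone,
whereas the range inherits one from the suspension of [J]; they agree for [A]
closed. A closed set of the suspension of [A] is seen on a compact test space
[C] of the cylinder on [J] as the union of the image of a compact subset of the
part [CA] of [C] lying over [A], and of the parts of [C] that lie over an end of
the cylinder, for the poles that belong to the set. *)
Lemma susp_closed_embedding (R : realType) (J : topologicalType) (A : set J) :
  closed A ->
  exists h : susp R (set_type A) -> susp R J,
    [/\ continuous h, injective h, forall F, closed F -> closed (h @` F) &
      range h = susp_set R A].
Proof.
move=> cA.
pose h0 (c : cylinder R A + bool) : susp R J :=
  match c with
  | inl p => susp_pt p.1 (set_val p.2)
  | inr b => susp_pole R J b
  end.
have h0r c d : susp_glue c d -> h0 c = h0 d.
  by case=> t x tE /=; exact: susp_pt_pole.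
pose h (z : susp R A) := h0 (repr z).
have hE c : h (\pi_(susp R A) c) = h0 c.
  by apply: (glued_lift h0r); exact: reprK.
have hpt t x : h (susp_pt t x) = susp_pt t (set_val x) by rewrite hE.
have hpole b : h (susp_pole R A b) = susp_pole R J b by rewrite hE.
exists h; split.
- apply/continuousP => W /susp_open oW; apply/susp_open.
  rewrite [X in open X](_ : _ =
      [set p : cylinder R A | W (susp_pt p.1 (set_val p.2))]); last first.
    by apply/funext => p; rewrite /= hpt.
  apply: (open_preimage (f := fun p : cylinder R A =>
    ((p.1, set_val p.2) : cylinder R J)) _ oW).
  apply: continuous_from_kify => C u cC hC cu.
  apply: continuous_to_kify => //; apply: continuous_pair.
    exact: continuous_compose cu (@continuous_fst _ _).
  apply: continuous_compose (@continuous_set_val _ A).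
  exact: continuous_compose cu (@continuous_snd _ _).
- apply: susp_ind => [b|t x]; apply: susp_ind => [c|u y]; rewrite ?hpt ?hpole.
  + by move=> /susp_pole_inj ->.
  + by move=> /esym/susp_pt_eq_pole/susp_pt_pole ->.
  + by move=> /susp_pt_eq_pole/susp_pt_pole ->.
  + move=> /susp_pt_eq[<- xy]; apply/susp_pt_eq; split=> // t0 t1.
    exact/val_inj/xy.
- move=> F cF; rewrite -openC; apply/susp_open.
  suff : closed [set p : cylinder R J | (h @` F) (susp_pt p.1 p.2)].
    by rewrite -openC.
  have cF' : closed [set p : cylinder R A | F (susp_pt p.1 p.2)].
    by move: cF; rewrite -openC => /susp_open oF; rewrite -openC.
  apply: closed_kify => C u cC hC cu.
  have cu1 := continuous_compose cu (@continuous_fst _ _).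
  have cu2 := continuous_compose cu (@continuous_snd _ _).
  pose CA : set C := [set c | A (u c).2].
  have cCA : compact CA.
    apply: subclosed_compact cC _ => //.
    by move/continuous_closedP: cu2; apply.
  have uA (c : CA) : (u (set_val c)).2 \in A by exact: mem_set (set_valP c).
  pose v (c : CA) : cylinder R A := ((u (set_val c)).1, SigSub (uA c) : A).
  have cv : continuous v.
    apply: continuous_to_kify.
    - exact: compact_set_type.
    - exact: hausdorff_inj (@continuous_set_val _ CA) val_inj hC.
    apply: continuous_pair.
      exact: continuous_compose (@continuous_set_val _ CA) cu1.
    apply: continuous_into_set.
    exact: continuous_compose (@continuous_set_val _ CA) cu2.
  pose K : set C := set_val @` (v @^-1` [set p | F (susp_pt p.1 p.2)]).
  have cK : closed K.
    apply: (compact_closed hC).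
    apply: continuous_compact.
      exact/continuous_subspaceT/continuous_set_val.
    apply: (subclosed_compact _ (compact_set_type cCA)) => //.
    by move/continuous_closedP: cv; apply.
  (* the part of [C] over the pole [b], if this pole belongs to [F] *)
  pose Z b := [set c | F (susp_pole R A b) /\ set_val (u c).1 = b%:R :> R].
  have cZ b : closed (Z b).
    have [Fb|nFb] := pselect (F (susp_pole R A b)); last first.
      rewrite (_ : Z b = set0); first exact: closed0.
      by apply/seteqP; split=> // c [].
    rewrite (_ : Z b = (fun c => set_val (u c).1) @^-1` [set b%:R : R]).
      move/continuous_closedP:
        (continuous_compose cu1 (@continuous_set_val _ _)); apply.
      exact: closed_eq.
    by apply/seteqP; split=> c // [].
  have cKZ := closedU (closedU cK (cZ false)) (cZ true).
  rewrite [X in closed X](_ : _ = K `|` Z false `|` Z true) //.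
  apply/seteqP; split=> c /=.
    move=> [z + hz]; move: z hz; apply: susp_ind => [b|t x].
      rewrite hpole => /esym/susp_pt_eq_pole tb Fb.
      by case: b tb Fb => tb Fb; [right|left; right]; split.
    rewrite hpt => /susp_pt_eq[tE xE] Fx.
    have [t0|t0] := eqVneq (set_val t : R) 0.
      by left; right; split; rewrite -?tE // -(@susp_pt_pole _ _ t x false).
    have [t1|t1] := eqVneq (set_val t : R) 1.
      by right; split; rewrite -?tE // -(@susp_pt_pole _ _ t x true).
    left; left.
    have {}xE : set_val x = (u c).2.
      apply: xE; rewrite lt_neqAle ?unitI_ge0 ?unitI_le1 ?andbT //.
      by rewrite eq_sym.
    have CAc : CA c by rewrite /CA /= -xE; exact: set_valP.
    exists (SigSub (mem_set CAc)) => //=; rewrite /v -tE /=.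
    congr (F _): Fx; congr susp_pt; exact: val_inj.
  case=> [[[a Fa <-]|[Fb tb]]|[Fb tb]].
  + by exists (susp_pt (v a).1 (v a).2) => //; rewrite hpt.
  + by exists (susp_pole R A false); rewrite // hpole (susp_pt_pole _ tb).
  + by exists (susp_pole R A true); rewrite // hpole (susp_pt_pole _ tb).
- apply/seteqP; split=> z.
    move=> [+ _ <-]; apply: susp_ind => [b|t x]; rewrite ?hpt ?hpole.
      by left; exists b.
    by right; exists t => //; exists (set_val x) => //; exact: set_valP.
  case=> [[b _ <-]|[t _ [x Ax <-]]]; first by exists (susp_pole R A b).
  by exists (susp_pt t (SigSub (mem_set Ax) : A)) => //; rewrite hpt.
Qed.

(** * Subcomplexes are closed *)

Lemma continuous_sum_fun (R : realType) (I : Type) (r : seq I)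
    (T : topologicalType) (f : I -> T -> R) :
  (forall i, continuous (f i)) -> continuous (fun x => \sum_(i <- r) f i x).
Proof.
move=> cf; apply: (@continuous_big R I +%R 0 xpredT) => //.
exact: add_continuous.
Qed.

Lemma disc_compact (R : realType) (d : nat) : compact (@disc R d).
Proof.
have seg := @rV_compact R d (fun=> `[(- 1 : R), 1]%classic)
  (fun=> @segment_compact R _ _).
apply: subclosed_compact seg _ => [|v vD i /=].
  have : continuous (@sqnorm R d).
    apply: continuous_sum_fun => i v.
    exact: (continuous_comp (@coord_continuous R 1 d 0 i v)
      (@exprn_continuous R 2 _)).
  move=> /continuous_closedP cs.
  by apply: (cs [set x : R | x <= 1]); exact: closed_le.
rewrite in_itv /= -ler_norml -(@expr_le1 _ 2) // real_normK ?num_real //.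
apply: le_trans vD; rewrite /sqnorm (bigD1 i) //= lerDl.
by apply: sumr_ge0 => j _; exact: sqr_ge0.
Qed.

(** By the weak topology, only the trace of [A] on the closure of a cell matters.
This closure meets finitely many open cells, by compactness of the disc and
closure finiteness, so the trace is the union of its traces on the closures of
those finitely many cells that lie in [A]. *)
Lemma subcomplex_closed (R : realType) (X : topologicalType)
    (S : CW_structure R X) (A : set X) :
  subcomplex S A -> closed A.
Proof.
move=> [E AE EA].
have cell_sub e : closure (open_cell e) `<=` @cell_map _ _ S e @` disc (d := _).
  rewrite closureE; apply: smallest_sub.
    apply: (compact_closed (CW_hausdorff S)).
    apply: continuous_compact; last exact: disc_compact.
    by apply: (CW_continuous (c := S)).
  by apply: image_subset => v; exact: ltW.
apply: (CW_weak (c := S)) => e.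
have [F [finF _] sphF] := CW_closure_finite e.
rewrite (_ : _ `&` _ = \bigcup_(e' in (F `|` [set e]) `&` E)
    (closure (open_cell e') `&` closure (open_cell e))).
  apply: (@closed_bigcup _ {classic cell S}).
    by apply: finite_setIl; rewrite finite_setU; split=> //; exact: finite_set1.
  by move=> e' _; apply: closedI; exact: closed_closure.
apply/seteqP; split=> x; last by move=> [e' [_ /EA Ae'] [/Ae' Ax ex]]; split.
move=> [Ax ex].
have [e' Fe' e'x] : exists2 e', (F `|` [set e]) e' & open_cell e' x.
  have [v vD vx] := cell_sub _ _ ex.
  have [v1|v1] := eqVneq (sqnorm v) 1.
    by have [|e' Fe' e'x] := sphF x; [exists v|exists e' => //; left].
  exists e; first by right.
  by exists v => //; rewrite /odisc /= lt_neqAle v1.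
have : A x by [].
rewrite {1}AE => -[e'' Ee'' e''x].
have e'E : e' = e''.
  by apply: (CW_disjoint (c := S)) => //; exists x.
exists e'; first by split=> //; rewrite e'E.
by split=> //; exact: subset_closure.
Qed.

Lemma CW_pair_closed (R : realType) (X : topologicalType) (A : set X) :
  CW_pair R A -> closed A.
Proof. by move=> [S]; exact: subcomplex_closed. Qed.

(** * From join coordinates to the cube *)

Lemma compact_hausdorff_quotient (T U : topologicalType) (f : T -> U) :
  compact [set: T] -> hausdorff_space U -> continuous f ->
  (forall u, exists t, f t = u) -> quotient_map f.
Proof.
move=> cT hU cf sf; split=> // W; split; last exact: open_preimage.
rewrite -!closedC => cW.
rewrite (_ : ~` W = f @` (~` (f @^-1` W))).
  apply: (compact_closed hU); apply: continuous_compact.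
    exact: continuous_subspaceT.
  exact: subclosed_compact cW cT _.
apply/seteqP; split=> u /=; last by case=> t Wft <-.
by have [t <-] := sf u; exists t.
Qed.

Section spread.
Context (R : realType) (n : nat).
Local Notation I := (unitI R).
Local Notation simplex := (simplex R n).

Lemma unitI_compact : compact [set: I].
Proof. exact/compact_set_type/segment_compact. Qed.

Lemma unitI_hausdorff : hausdorff_space I.
Proof.
exact: hausdorff_inj (@continuous_set_val _ _) val_inj (@Rhausdorff R).
Qed.

Definition weight (t : simplex) (i : 'I_n) : R := (set_val t : 'rV[R]_n) 0 i.

Lemma weight_ge0 t i : 0 <= weight t i.
Proof. exact: (set_valP t).1. Qed.

Lemma weight_sum t : \sum_(i < n) weight t i = 1.
Proof. exact: (set_valP t).2. Qed.

Lemma continuous_weight i : continuous (fun t => weight t i).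
Proof.
exact: (continuous_compose (@continuous_set_val 'rV[R]_n _)
  (@coord_continuous R 1 n 0 i)).
Qed.

Lemma simplex_eq (t u : simplex) : (forall i, weight t i = weight u i) -> t = u.
Proof. by move=> tu; apply/val_inj/rowP. Qed.

Lemma simplex_compact : compact [set: simplex].
Proof.
apply: compact_set_type.
have seg := @rV_compact R n (fun=> `[(0 : R), 1]%classic)
  (fun=> @segment_compact R _ _).
apply: subclosed_compact seg _ => [|v [v0 v1] i /=]; last first.
  rewrite in_itv /= v0 -v1 (bigD1 i) //= lerDl.
  by apply: sumr_ge0 => j _; exact: v0.
rewrite (_ : mkset _ =
    \bigcap_(i in [set: 'I_n]) [set v : 'rV[R]_n | 0 <= v 0 i] `&`
    [set v : 'rV[R]_n | \sum_(i < n) v 0 i = 1]); last first.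
  by apply/seteqP; split=> v /= [v0 v1]; split=> // i; [move=> _|]; exact: v0.
apply: closedI.
  apply: closed_bigI => i _.
  have /continuous_closedP cv := @coord_continuous R 1 n 0 i.
  by apply: (cv [set x : R | 0 <= x]); exact: closed_ge.
have /continuous_closedP cv :
    continuous (fun v : 'rV[R]_n => \sum_(i < n) v 0 i).
  by apply: continuous_sum_fun => i; exact: coord_continuous.
by apply: (cv [set x : R | x = 1]); exact: closed_eq.
Qed.

Lemma simplex_hausdorff : hausdorff_space simplex.
Proof.
apply: (hausdorff_inj (@continuous_set_val 'rV[R]_n _) val_inj).
exact: norm_hausdorff.
Qed.

(** The norm of matrices is the maximum norm, so this is the largest weight. *)
Definition peak (t : simplex) : R := `|set_val t : 'rV[R]_n|.

Lemma continuous_peak : continuous peak.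
Proof.
exact: (continuous_compose (@continuous_set_val 'rV[R]_n _)
  (@norm_continuous R 'rV[R]_n)).
Qed.

Lemma weight_le_peak t i : weight t i <= peak t.
Proof.
rewrite /peak [leRHS]/Num.Def.normr /= mx_normrE.
rewrite -[leLHS]ger0_norm ?weight_ge0 //.
exact: (le_bigmax _ (fun ij => `|(set_val t : 'rV[R]_n) ij.1 ij.2|) (0, i)).
Qed.

Lemma peak_gt0 t : 0 < peak t.
Proof.
rewrite /peak normr_gt0; apply/eqP => t0.
have := weight_sum t; rewrite /weight t0.
under eq_bigr do rewrite mxE.
by rewrite big1 // => /esym/eqP; rewrite oner_eq0.
Qed.

Lemma peak_attained t : exists i, weight t i = peak t.
Proof.
have [|[a i] /= E] := @mx_norm_neq0 _ _ _ (set_val t : 'rV[R]_n).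
  exact/lt0r_neq0/peak_gt0.
exists i; rewrite /peak [RHS]/Num.Def.normr /= E ord1 ger0_norm //.
exact: weight_ge0.
Qed.

Lemma weight_peak_ge0 t i : 0 <= weight t i / peak t.
Proof. by rewrite divr_ge0 ?weight_ge0 // ltW ?peak_gt0. Qed.

Lemma weight_peak_le1 t i : weight t i / peak t <= 1.
Proof. by rewrite ler_pdivrMr ?peak_gt0 // mul1r weight_le_peak. Qed.

(** The height above [x i] in the suspension of [X i] of the point that
corresponds to the point at height [s] above [sum_i t_i x_i] in the suspension
of the join. Measured downwards from the cone point at height 1, the heights are
proportional to the weights, with largest value [1 - s]. *)
Let coord_height (s : I) (t : simplex) (i : 'I_n) : R :=
  1 - (1 - set_val s) * (weight t i / peak t).

Lemma coord_height_ge s t i : set_val s <= coord_height s t i.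
Proof.
rewrite /coord_height lerBrDl -lerBrDr ler_piMr ?weight_peak_le1 //.
by rewrite subr_ge0 unitI_le1.
Qed.

Lemma coord_height_le1 s t i : coord_height s t i <= 1.
Proof.
by rewrite /coord_height gerBl mulr_ge0 ?weight_peak_ge0 // subr_ge0 unitI_le1.
Qed.

Lemma coord_height_in s t i : coord_height s t i \in `[0, 1]%classic.
Proof.
rewrite mem_setE in_itv /= coord_height_le1 andbT.
exact: le_trans (unitI_ge0 s) (coord_height_ge s t i).
Qed.

Definition spread (s : I) (t : simplex) : prod_topology (fun _ : 'I_n => I) :=
  fun i => SigSub (coord_height_in s t i).

Lemma spreadE s t i :
  set_val (spread s t i) = 1 - (1 - set_val s) * (weight t i / peak t) :> R.
Proof. by []. Qed.

Lemma spread_ge s t i : (set_val s : R) <= set_val (spread s t i).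
Proof. exact: coord_height_ge. Qed.

(** With [spread_ge], the smallest coordinate of [spread s t] is [s]; so some
coordinate is [0] exactly when [s] is. *)
Lemma spread_attained s t : exists i, spread s t i = s.
Proof.
have [i ti] := peak_attained t; exists i; apply: val_inj => /=.
by rewrite /coord_height ti divff ?lt0r_neq0 ?peak_gt0 // mulr1 subKr.
Qed.

Lemma spread_eq1 s t i :
  set_val (spread s t i) = 1 :> R <-> set_val s = 1 :> R \/ weight t i = 0.
Proof.
rewrite spreadE; split=> [/eqP|[->|->]]; rewrite ?subrr ?mul0r ?mulr0 ?subr0 //.
rewrite -subr_eq0 addrAC subrr add0r oppr_eq0 !mulf_eq0 invr_eq0.
rewrite (gt_eqF (peak_gt0 t)) orbF subr_eq0 => /orP[/eqP <-|/eqP ->].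
  by left.
by right.
Qed.

(** The smallest coordinate is [s]. If it is not [1], the other coordinates give
the weights up to the factor [peak], which is determined as their sum is [1]. *)
Lemma spread_inj s s' t t' : spread s t = spread s' t' ->
  s = s' /\ ((set_val s : R) < 1 -> t = t').
Proof.
move=> E.
have sle u v a b : spread u a = spread v b -> (set_val u : R) <= set_val v.
  by move=> ab; have [i <-] := spread_attained v b; rewrite -ab spread_ge.
have ss' : s = s'.
  apply/val_inj/eqP; rewrite eq_le; apply/andP.
  by split; [exact: sle E|exact: sle (esym E)].
split=> // s1; rewrite -{}ss' in E.
have ratio i : weight t i / peak t = weight t' i / peak t'.
  have := congr1 (fun f => 1 - set_val (f i) : R) E.
  rewrite /= !spreadE !subKr => /mulfI; apply.
  by rewrite subr_eq0 gt_eqF.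
have pp : (peak t)^-1 = (peak t')^-1.
  rewrite -[LHS]mul1r -[RHS]mul1r -{1}(weight_sum t) -(weight_sum t').
  by rewrite !mulr_suml; apply: eq_bigr => i _; exact: ratio.
apply: simplex_eq => i; have := ratio i; rewrite pp => /mulIf; apply.
by rewrite invr_eq0 lt0r_neq0 ?peak_gt0.
Qed.

Lemma continuous_spread :
  continuous (fun p : (I * simplex)%type => spread p.1 p.2).
Proof.
have cs : continuous (fun p : (I * simplex)%type => set_val p.1 : R).
  exact: continuous_compose (@continuous_fst I _) (@continuous_set_val R _).
have cw i : continuous (fun p : (I * simplex)%type => weight p.2 i).
  exact: continuous_compose (@continuous_snd I _) (@continuous_weight i).
have cp : continuous (fun p : (I * simplex)%type => peak p.2).
  exact: continuous_compose (@continuous_snd I _) continuous_peak.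
apply: continuous_tuple => i; apply: continuous_into_set => p.
apply: cvgB; first exact: cvg_cst.
apply: cvgM; first by apply: cvgB (cs p); exact: cvg_cst.
by apply: cvgM (cw i p) _; apply: cvgV (cp p); exact/lt0r_neq0/peak_gt0.
Qed.

(** A point of the cube other than [(1, .., 1)] is reached from the distances
[w] of its coordinates to [1]: normalized to sum [1] they give the weights, and
their maximum gives [1 - s]. The weights are arbitrary for [(1, .., 1)]. *)
Lemma spread_surj : (0 < n)%N ->
  forall r : prod_topology (fun _ : 'I_n => I),
  exists p : I * simplex, spread p.1 p.2 = r.
Proof.
move=> n0 r; pose w : 'rV[R]_n := \row_i (1 - set_val (r i)).
have wE i : w 0 i = 1 - set_val (r i) by rewrite mxE.
have w0 i : 0 <= w 0 i by rewrite wE subr_ge0 unitI_le1.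
have [wz|wnz] := eqVneq w 0.
  pose v : 'rV[R]_n := delta_mx 0 (Ordinal n0).
  have vP : v \in [set t : 'rV[R]_n | (forall i, 0 <= t 0 i) /\
      \sum_(i < n) t 0 i = 1].
    apply/mem_set; split=> [i|]; first by rewrite mxE ler0n.
    rewrite (bigD1 (Ordinal n0)) //= mxE !eqxx big1 ?addr0 // => i i0.
    by rewrite mxE (negbTE i0) andbF.
  have oneP : (1 : R) \in `[0, 1]%classic.
    by rewrite mem_setE in_itv /= ler01 lexx.
  exists (SigSub oneP, SigSub vP); apply: functional_extensionality_dep => i.
  apply: val_inj => /=; rewrite /coord_height /= subrr mul0r subr0.
  by apply/eqP; rewrite -subr_eq0 -wE wz mxE.
have normw : exists i, `|w| = w 0 i.
  have [|[a i] /= E] := @mx_norm_neq0 _ _ _ w.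
    by rewrite -[mx_norm w]/(`|w|) normr_eq0.
  by exists i; rewrite [LHS]/Num.Def.normr /= E ord1 ger0_norm.
have [i normwE] := normw.
have S0 : 0 < \sum_i w 0 i.
  by rewrite (bigD1 i) //= ltr_wpDr ?sumr_ge0 // -normwE normr_gt0.
set S := \sum_i w 0 i in S0.
have vP : S^-1 *: w \in [set t : 'rV[R]_n | (forall i, 0 <= t 0 i) /\
    \sum_(i < n) t 0 i = 1].
  apply/mem_set; split=> [j|]; first by rewrite mxE mulr_ge0 ?invr_ge0 // ltW.
  by under eq_bigr do rewrite mxE; rewrite -mulr_sumr mulVf ?gt_eqF.
have sP : 1 - `|w| \in `[0, 1]%classic.
  rewrite mem_setE in_itv /= subr_ge0 gerBl normr_ge0 andbT normwE wE.
  by rewrite gerBl unitI_ge0.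
exists (SigSub sP, SigSub vP); apply: functional_extensionality_dep => j.
apply: val_inj => /=; rewrite /coord_height /weight /peak /= subKr mxE normrZ.
rewrite gtr0_norm ?invr_gt0 // -mulf_div divff ?mul1r; last first.
  by rewrite invr_eq0 gt_eqF.
by rewrite mulrCA divff ?normr_eq0 // mulr1 wE subKr.
Qed.

(** This replaces continuity of an inverse: for [n > 1] the weights of a point of
the cube have no continuous extension to [(1, .., 1)], but a continuous surjection from a
compact space to a Hausdorff one is a quotient map. *)
Lemma spread_quotient_map : (0 < n)%N ->
  quotient_map (fun p : (I * simplex)%type => spread p.1 p.2).
Proof.
move=> n0; apply: compact_hausdorff_quotient (spread_surj n0).
- by apply: compact_setXT; [exact: unitI_compact|exact: simplex_compact].
- by apply: hausdorff_product => _; exact: unitI_hausdorff.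
- exact: continuous_spread.
Qed.

End spread.

(** * Two quotients of the same space *)

Lemma closed_kify_coarse (T : topologicalType) (F : set T) :
  closed F -> closed (F : set (kify T)).
Proof.
move=> cF; have /continuous_closedP := continuous_kify (@continuous_ident T).
exact.
Qed.

Lemma continuous_susp_pt (R : realType) (X : topologicalType) :
  continuous (fun p : cylinder R X => susp_pt p.1 p.2).
Proof. by apply/continuousP => W /susp_open. Qed.

(** Over a nonempty space, the poles are covered by the ends of the cylinder. *)
Lemma susp_pt_quotient_map (R : realType) (X : topologicalType) :
  inhabited X -> quotient_map (fun p : cylinder R X => susp_pt p.1 p.2).
Proof.
move=> [x0]; split=> [|W]; last exact: iff_sym (susp_open W).
have end_in (b : bool) : (b%:R : R) \in `[0, 1]%classic.
  by rewrite mem_setE in_itv /=; case: b; rewrite ?lexx ?ler01.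
apply: susp_ind => [b|t x]; last by exists (t, x).
by exists (SigSub (end_in b) : unitI R, x0); exact: susp_pt_pole.
Qed.

Lemma susp_set_pole (R : realType) (X : topologicalType) (A : set X) b :
  susp_set R A (susp_pole R X b).
Proof. by left; exists b. Qed.

Lemma susp_set_pt (R : realType) (X : topologicalType) (A : set X)
    (t : unitI R) (x : X) :
  0 < (set_val t : R) -> (set_val t : R) < 1 ->
  susp_set R A (susp_pt t x) <-> A x.
Proof.
move=> t0 t1; split=> [[[b _ /esym/susp_pt_eq_pole tb]|[u _ [y Ay E]]]|Ax].
- by move: t0 t1; rewrite tb; case: b {tb}; rewrite ltxx.
- by move: E Ay => /esym/susp_pt_eq[_ ->].
- by right; exists t => //; exists x.
Qed.

(** Membership of [sum_i t_i x_i] in the piece of a simplex says that, for each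
[i], either [t_i] vanishes or [x_i] lies in the [i]-th space of this piece: a
closed condition on [(t, x)]. *)
Lemma polyhedral_join_closed (R : realType) (n : nat) (K : {set {set 'I_n}})
    (X : 'I_n -> topologicalType) (A : forall i, set (X i)) :
  (forall i, closed (A i)) -> closed (polyhedral_join R K A).
Proof.
move=> cA; rewrite -openC; apply/(glued_quotient_map _).2.
rewrite preimage_setC openC; apply: closed_kify_coarse.
pose E (s : {set 'I_n}) : set (simplex R n * prod_topology X) :=
  \bigcap_(i in [set: 'I_n]) ([set p | weight p.1 i <= 0] `|`
     [set p | face_family A s (p.2 i)]).
rewrite [Z in closed Z](_ : _ = \bigcup_(s in [set s | s \in K]) E s);
    last first.
  apply/seteqP; split=> p [s sK].
    move=> [q qY /join_eqP[qp1 qp2]]; exists s => // i _.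
    have [ti|ti] := leP (weight p.1 i) 0; [by left|right].
    have qi : 0 < weight q.1 i by rewrite qp1.
    by rewrite /= -(qp2 i qi); exact: qY.
  move=> Ep; exists s => //; exists p => // i ti.
  by case: (Ep i I) => //=; rewrite leNgt ti.
apply: closed_bigcup => [|s _].
  exact: finite_finset.
apply: closed_bigI => i _; apply: closedU.
  have /continuous_closedP cw := continuous_compose
    (@continuous_fst _ (prod_topology X)) (@continuous_weight R n i).
  by apply: (cw [set y : R | y <= 0]); exact: closed_le.
have /continuous_closedP cx := continuous_compose
  (@continuous_snd (simplex R n) (prod_topology X)) (@continuous_proj _ X i).
apply: cx; rewrite /face_family; case: ifP => _; [exact: closedT|exact: cA].
Qed.

Section comparison.
Context (R : realType) (n : nat) (X : 'I_n -> topologicalType).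
Local Notation I := (unitI R).
Local Notation J := (join R X).
Local Notation SX := (fun i : 'I_n => susp R (X i) : ptopologicalType).
Local Notation join_cylinder :=
  (kify (I * (simplex R n * prod_topology X))%type).

(** The two adjoined points lie over the poles of the suspended join. For
[n = 0] the simplex is empty and they are the only points. *)
Definition join_coords : topologicalType := (join_cylinder + bool)%type.

Definition susp_join_of (c : join_coords) : susp R J :=
  match c with
  | inl p => susp_pt p.1 (\pi_J p.2)
  | inr b => susp_pole R J b
  end.

Definition spread_susp (s : I) (t : simplex R n) (x : prod_topology X) :
    prod_topology SX :=
  fun i => susp_pt (spread s t i) (x i).

Definition apex : prod_topology SX := fun i => susp_pole R (X i) true.

Definition smash_susp_of (c : join_coords) : smash SX :=
  match c with
  | inl p => smash_pt (spread_susp p.1 p.2.1 p.2.2)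
  | inr b => if b then smash_pt apex else smash_base SX
  end.

Lemma continuous_spread_susp (C : topologicalType)
    (u : C -> (I * (simplex R n * prod_topology X))%type) :
  compact [set: C] -> hausdorff_space C -> continuous u ->
  continuous (fun c => spread_susp (u c).1 (u c).2.1 (u c).2.2).
Proof.
move=> cC hC cu.
have cs := continuous_compose cu (@continuous_fst _ _).
have ctx := continuous_compose cu (@continuous_snd _ _).
have ct := continuous_compose ctx (@continuous_fst _ _).
have cx := continuous_compose ctx (@continuous_snd _ _).
apply: continuous_tuple => i.
apply: (@continuous_compose C (cylinder R (X i)) (susp R (X i))
  (fun c => (spread (u c).1 (u c).2.1 i, (u c).2.2 i))
  (fun p => susp_pt p.1 p.2)).
  apply: continuous_to_kify => //; apply: continuous_pair.
    have cst := continuous_pair cs ct.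
    exact: (continuous_compose (continuous_compose cst (@continuous_spread R n))
      (@continuous_proj _ (fun=> I) i)).
  exact: continuous_compose cx (@continuous_proj _ X i).
exact: continuous_susp_pt.
Qed.

(** The interval is compact, so it may be multiplied with the quotient map onto
the join and with the compactly generated product that this map starts from. *)
Lemma susp_join_of_quotient_map : quotient_map susp_join_of.
Proof.
split.
  apply: susp_ind => [b|s j]; first by exists (inr b).
  by have [p <-] := glued_surj j; exists (inl (s, p)).
move=> W; apply: iff_trans (open_sum_discrete _) _.
apply: iff_trans (iff_sym (susp_open W)); split=> oW.
  suff : open [set p : (I * J)%type | W (susp_pt p.1 p.2)].
    by move=> oIJ; apply/open_kify => C u cC hC cu; exact: open_preimage cu oIJ.
  apply: (open_prod_quotient (@unitI_compact R) (@unitI_hausdorff R)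
    (glued_quotient_map _)).
  apply: (open_prod_kspace (@unitI_compact R) (@unitI_hausdorff R)
    (@kspace_kify _)) => C u cC hC cu.
  apply: (oW C (fun c =>
    ((u c).1, (u c).2 : simplex R n * prod_topology X))) => //.
  apply: continuous_pair.
    exact: continuous_compose cu (@continuous_fst _ _).
  exact: (continuous_compose (continuous_compose cu (@continuous_snd _ _))
    (continuous_kify (@continuous_ident (simplex R n * prod_topology X)%type))).
apply/open_kify => C u cC hC cu.
apply: (oW C (fun c => ((u c).1, \pi_J ((u c).2 : join_pre R X)))) => //.
apply: continuous_pair.
  exact: continuous_compose cu (@continuous_fst _ _).
apply: (@continuous_compose _ (join_pre R X)).
  apply: continuous_to_kify => //.
  exact: continuous_compose cu (@continuous_snd _ _).
exact: quotient_map_continuous (glued_quotient_map _).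
Qed.

Hypothesis X_inhabited : forall i, inhabited (X i).

(** A set of the smash product is tested on a map from a compact space [C] to the
product of the suspensions, which [kopen_prod_quotient] allows to be of the form
[c |-> (rho_i c, xi_i c)] in the product of the cylinders. The set of all
[(c, r)] such that heights [r] over [xi c] give a point of [W] is open in
[C * I^n]: by [spread_quotient_map] this may be checked after replacing the cube
by the product of the interval and the simplex, where it is the hypothesis. *)
Lemma smash_susp_of_quotient_map : quotient_map smash_susp_of.
Proof.
have ptq i := susp_pt_quotient_map R (X_inhabited i).
split.
  apply: smash_ind => [|y]; first by exists (inr false).
  have [n0|n0] := posnP n.
    exists (inr true) => /=; congr smash_pt.
    by apply: functional_extensionality_dep => i; have := ltn_ord i;
      rewrite [leqRHS]n0.
  pose c i := projT1 (cid ((ptq i).1 (y i))).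
  have cE i : susp_pt (c i).1 (c i).2 = y i by rewrite /c; case: cid.
  have [[s t] /= stE] := spread_surj n0 (fun i => (c i).1).
  exists (inl (s, (t, fun i => (c i).2))); congr smash_pt.
  by apply: functional_extensionality_dep => i; rewrite /spread_susp stE cE.
move=> W; apply: iff_trans (open_sum_discrete _) _.
apply: iff_trans (iff_sym (smash_open W)); split=> oW; last first.
  apply/open_kify => C u cC hC cu.
  apply: (oW C (fun c => spread_susp (u c).1 (u c).2.1 (u c).2.2)) => //.
  exact: continuous_spread_susp.
(* for [n = 0] the product is a point, so every subset of it is open *)
apply/open_kify; have [n0|n0] := posnP n.
  move=> C f cC hC cf; set V := f @^-1` _.
  have VE c d : V c -> V d.
    rewrite /V /=; congr (W (smash_pt _)).
    by apply: functional_extensionality_dep => i; have := ltn_ord i;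
      rewrite [leqRHS]n0.
  have [V0|/eqP/set0P[c Vc]] := pselect (V = set0).
    by rewrite V0; exact: open0.
  rewrite (_ : V = setT); first exact: openT.
  by apply/seteqP; split=> d // _; exact: VE Vc.
apply: (kopen_prod_quotient ptq) => [i|]; first exact: kspace_kify.
move=> C u cC hC cu.
have cui i := continuous_compose (continuous_compose cu
  (@continuous_proj _ _ i)) (continuous_kify (@continuous_ident _)).
pose rho c : prod_topology (fun _ : 'I_n => I) := fun i => (u c i).1.
pose xi c : prod_topology X := fun i => (u c i).2.
have crho : continuous rho.
  apply: continuous_tuple => i.
  exact: continuous_compose (cui i) (@continuous_fst _ _).
have cxi : continuous xi.
  apply: continuous_tuple => i.
  exact: continuous_compose (cui i) (@continuous_snd _ _).
pose O := [set p : (C * prod_topology (fun _ : 'I_n => I))%type |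
  W (smash_pt (fun i => susp_pt (p.2 i) (xi p.1 i) : SX i))].
have oO : open O.
  apply: (open_prod_quotient cC hC (spread_quotient_map R n0)).
  apply: (oW _ (fun p : (C * (I * simplex R n))%type =>
    (p.2.1, (p.2.2, xi p.1)))).
  - apply: compact_setXT cC _.
    exact: compact_setXT (@unitI_compact R) (@simplex_compact R n).
  - apply: hausdorff_setX hC _.
    exact: hausdorff_setX (@unitI_hausdorff R) (@simplex_hausdorff R n).
  have c2 := @continuous_snd C (I * simplex R n)%type.
  apply: continuous_pair.
    exact: continuous_compose c2 (@continuous_fst _ _).
  apply: continuous_pair.
    exact: continuous_compose c2 (@continuous_snd _ _).
  exact: continuous_compose (@continuous_fst _ _) cxi.
apply: (open_preimage (f := fun c => (c, rho c)) _ oO).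
exact: continuous_pair (@continuous_ident C) crho.
Qed.

End comparison.

(** * Comparing the fibres *)

Section fibres.
Context (R : realType) (n : nat) (X : 'I_n -> topologicalType).
Local Notation J := (join R X).
Local Notation SX := (fun i : 'I_n => susp R (X i) : ptopologicalType).
Implicit Types (s : unitI R) (t : simplex R n) (x : prod_topology X).
Implicit Types c d : join_coords R X.

(** The height in the suspended join. The values [0] and [1] single out the two
points, the base point and the apex, at which coordinates get lost. *)
Definition level c : R :=
  match c with inl p => set_val p.1 | inr b => b%:R end.

Lemma susp_join_of_pole c b :
  susp_join_of c = susp_pole R J b <-> level c = b%:R.
Proof.
case: c => [[s p]|b'] /=; first exact: susp_pt_eq_pole.
split=> [/susp_pole_inj->//|]; case: b b' => -[] //= /eqP.
  by rewrite eq_sym oner_eq0.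
by rewrite oner_eq0.
Qed.

Lemma spread_susp_base s t x :
  smash_pt (spread_susp s t x) = smash_base SX <-> set_val s = 0 :> R.
Proof.
apply: iff_trans (smash_pt_eq_base _) _; split=> [[i]|s0].
  move=> /(susp_pt_eq_pole _ _ false) si0; apply/eqP.
  by rewrite eq_le unitI_ge0 andbT; have := spread_ge s t i; rewrite si0.
have [i si] := spread_attained s t; exists i.
by apply: (susp_pt_pole _ (b := false)); rewrite si.
Qed.

Lemma apex_neq_base : smash_pt (apex R X) <> smash_base SX.
Proof. by move=> /smash_pt_eq_base[i] /susp_pole_inj. Qed.

Lemma smash_susp_of_base c : smash_susp_of c = smash_base SX <-> level c = 0.
Proof.
case: c => [[s [t x]]|[]] /=; first exact: spread_susp_base.
  by split=> [/apex_neq_base//|/eqP]; rewrite oner_eq0.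
by [].
Qed.

Lemma smash_susp_of_apex c :
  smash_susp_of c = smash_pt (apex R X) <-> level c = 1.
Proof.
case: c => [[s [t x]]|[]] /=; last first.
- by split=> [/esym/apex_neq_base//|/esym/eqP]; rewrite oner_eq0.
- by [].
split=> [E|s1].
  have [i <-] := spread_attained s t.
  have /(congr1 (fun y : prod_topology SX => y i)) :=
    smash_pt_inj apex_neq_base (esym E).
  by move=> /esym/(susp_pt_eq_pole _ _ true).
congr smash_pt; apply: functional_extensionality_dep => i.
by apply: (susp_pt_pole _ (b := true)); apply/spread_eq1; left.
Qed.

Lemma interior_spread s t i :
  0 < (set_val s : R) -> (set_val s : R) < 1 -> 0 < weight t i ->
  0 < (set_val (spread s t i) : R) < 1.
Proof.
move=> s0 s1 ti; rewrite (lt_le_trans s0 (spread_ge s t i)) /=.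
rewrite lt_neqAle unitI_le1 andbT; apply/eqP => /spread_eq1[s1'|t0].
  by move: s1; rewrite s1' ltxx.
by move: ti; rewrite t0 ltxx.
Qed.

Lemma level_cases c : [\/ level c = 0, level c = 1 |
  exists s t x, [/\ c = inl (s, (t, x)), 0 < (set_val s : R) &
    (set_val s : R) < 1]].
Proof.
case: c => [[s [t x]]|[]] /=; last 2 first.
- by constructor 2.
- by constructor 1.
have [s0|s0] := eqVneq (set_val s : R) 0; first by constructor 1.
have [s1|s1] := eqVneq (set_val s : R) 1; first by constructor 2.
constructor 3; exists s, t, x; split=> //; rewrite lt_neqAle.
  by rewrite eq_sym s0 unitI_ge0.
by rewrite s1 unitI_le1.
Qed.

(** Strictly between the two poles, a point of the suspended join determines its
height, its weights and those [x_i] whose weight is positive. On the other side,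
[spread_inj] recovers height and weights from the heights of the coordinates,
and a coordinate remembers [x_i] exactly when it is not at height 1, that is,
when its weight is positive. *)
Lemma same_fibres c d :
  susp_join_of c = susp_join_of d <-> smash_susp_of c = smash_susp_of d.
Proof.
have at0 a b : level a = 0 ->
    susp_join_of a = susp_join_of b <-> smash_susp_of a = smash_susp_of b.
  move=> a0; rewrite ((susp_join_of_pole a false).2 a0).
  rewrite ((smash_susp_of_base a).2 a0).
  apply: iff_trans (_ : level b = 0 <-> _).
    by split=> [/esym/(susp_join_of_pole b false)|/(susp_join_of_pole b false)].
  by split=> [/smash_susp_of_base|/esym/smash_susp_of_base].
have at1 a b : level a = 1 ->
    susp_join_of a = susp_join_of b <-> smash_susp_of a = smash_susp_of b.
  move=> a1; rewrite ((susp_join_of_pole a true).2 a1).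
  rewrite ((smash_susp_of_apex a).2 a1).
  apply: iff_trans (_ : level b = 1 <-> _).
    by split=> [/esym/(susp_join_of_pole b true)|/(susp_join_of_pole b true)].
  by split=> [/smash_susp_of_apex|/esym/smash_susp_of_apex].
have symm (S : Type) (a b : S) : a = b <-> b = a by split.
have [c0|c1|[s [t [x [-> s0 s1]]]]] := level_cases c; [exact: at0|exact: at1|].
have [d0|d1|[s' [t' [x' [-> s0' s1']]]]] := level_cases d.
- by apply: iff_trans (symm _ _ _) (iff_trans (at0 _ _ d0) (symm _ _ _)).
- by apply: iff_trans (symm _ _ _) (iff_trans (at1 _ _ d1) (symm _ _ _)).
rewrite /=; split.
  move=> /susp_pt_eq[<-] /(_ s0 s1) /join_eqP[/= <- xx'].
  congr smash_pt; apply: functional_extensionality_dep => i.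
  apply/susp_pt_eq; split=> // _ si1; apply: xx'.
  rewrite lt_neqAle weight_ge0 andbT eq_sym; apply/eqP => t0.
  by move: si1; rewrite (spread_eq1 _ _ _).2 ?ltxx //; right.
move=> /smash_pt_inj E.
have {}E : spread_susp s t x = spread_susp s' t' x'.
  by apply: E => /spread_susp_base sz; move: s0; rewrite sz ltxx.
have Ei i : spread s t i = spread s' t' i /\
    (0 < (set_val (spread s t i) : R) ->
     (set_val (spread s t i) : R) < 1 -> x i = x' i).
  by apply/susp_pt_eq; exact: (congr1 (fun y : prod_topology SX => y i) E).
have [<- /(_ s1) <-] : s = s' /\ ((set_val s : R) < 1 -> t = t').
  apply: spread_inj; apply: functional_extensionality_dep => i.
  exact: (Ei i).1.
congr susp_pt; apply/join_eqP; split=> //= i ti.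
by have /andP[si0 si1] := interior_spread s0 s1 ti; exact: (Ei i).2.
Qed.

(** A coordinate [susp_pt u x_i] belongs to the suspension of [A i] when [x_i]
is in [A i] or [u] is [0] or [1]. Away from the poles the second case means that
the weight of [x_i] vanishes, which is the condition that the join imposes. *)
Lemma polyhedral_image (K : {set {set 'I_n}}) (A : forall i, set (X i)) c :
  simplicial_complex K ->
  polyhedral_smash SX K (fun i => susp_set R (A i)) (smash_susp_of c) <->
  susp_set R (polyhedral_join R K A) (susp_join_of c).
Proof.
move=> [K0 _].
have [c0|c1|[s [t [x [-> s0 s1]]]]] := level_cases c.
(* the poles are met in the piece of the empty simplex *)
- rewrite ((susp_join_of_pole c false).2 c0) ((smash_susp_of_base c).2 c0).
  split=> _; first exact: susp_set_pole.
  by exists finset.set0 => //; left.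
- rewrite ((susp_join_of_pole c true).2 c1) ((smash_susp_of_apex c).2 c1).
  split=> _; first exact: susp_set_pole.
  exists finset.set0 => //; right; exists (apex R X) => // i.
  by rewrite /face_family inE; exact: susp_set_pole.
apply: iff_trans (iff_sym (susp_set_pt _ _ s0 s1)).
split=> [[sig sK]|[sig sK [[t' x'] /= tY /join_eqP[/= tt' xx']]]].
  case=> [/spread_susp_base sz|[y yY /esym/smash_pt_inj E]].
    by move: s0; rewrite sz ltxx.
  have {}E : spread_susp s t x = y.
    by apply: E => /spread_susp_base sz; move: s0; rewrite sz ltxx.
  exists sig => //; exists (t, x) => // i ti.
  have := yY i; rewrite /face_family -E; case: ifP => // _.
  have /andP[si0 si1] := interior_spread s0 s1 ti.
  by move=> /(susp_set_pt _ _ si0 si1).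
exists sig => //; right; exists (spread_susp s t x) => // i.
have := tY i; rewrite tt' /face_family; case: ifP => // _ At.
have [t0|t0] := eqVneq (weight t i) 0.
  rewrite /spread_susp (@susp_pt_pole _ _ _ _ true); first exact: susp_set_pole.
  by apply/spread_eq1; right.
have ti : 0 < weight t i by rewrite lt_neqAle eq_sym t0 weight_ge0.
have /andP[si0 si1] := interior_spread s0 s1 ti.
by apply/susp_set_pt => //; rewrite -xx' ?tt' //; exact: At.
Qed.

End fibres.

Theorem theorem7 (R : realType) (n : nat) (K : {set {set 'I_n}})
    (X : 'I_n -> topologicalType) (A : forall i : 'I_n, set (X i)) :
  simplicial_complex K ->
  (forall i : 'I_n, inhabited (X i)) ->
  (forall i : 'I_n, CW_pair R (A i)) ->
  homotopy_equivalent R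
    (susp R (set_type (polyhedral_join R K A)))
    (set_type (polyhedral_smash (fun i : 'I_n => susp R (X i)) K
       (fun i : 'I_n => susp_set R (A i)))).
Proof.
move=> simpK X0 cwA.
have cJ : closed (polyhedral_join R K A).
  by apply: polyhedral_join_closed => i; exact: CW_pair_closed (cwA i).
have [i [ci iI iC iR]] := susp_closed_embedding R cJ.
have [h [hE ch hI hC]] := quotient_comparison
  (@susp_join_of_quotient_map R n X) (smash_susp_of_quotient_map R X0)
  (@same_fibres R n X).
apply: (@closed_embedding_homotopy_equivalent R _ _ (h \o i)).
- exact: continuous_compose ci ch.
- exact: inj_comp.
- by move=> F /iC/hC; rewrite image_comp.
apply/seteqP; split=> z /=.
  move=> [w _ <-].
  have : susp_set R (polyhedral_join R K A) (i w) by rewrite -iR; exists w.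
  have [c <-] := (@susp_join_of_quotient_map R n X).1 (i w).
  by rewrite hE => /(polyhedral_image A c simpK).
have [c <-] := (smash_susp_of_quotient_map R X0).1 z.
move=> /(polyhedral_image A c simpK); rewrite -iR => -[w _ iw].
by exists w => //; rewrite /= iw hE.
Qed.
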